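(* Let $(A(n))_{n\ge1}$ be an i.i.d. sequence of random $(\max,+)$ operators on $\mathbb R^d$ with the memory loss property, such that $\|A(1)0\|_\infty$ has a finite $(4+\epsilon)$-th moment for some $\epsilon>0$, and let $X^0\in L^\infty$ be independent of $(A(n))$. If $(A(n))$ is algebraically arithmetic, then there exist $a,b\in\mathbb R$ such that $$\{\rho_{\max}(B): B\in S_A,\ \mathcal G(B)\text{ strongly connected}\}\subset a+b\mathbb Z.$$
   Context: $\mathbb R_{\max}=\mathbb R\cup\{-\infty\}$. A $d\times d$ matrix $A$ over $\mathbb R_{\max}$ with no row identically $-\infty$ defines a $(\max,+)$ operator on $\mathbb R^d$ by $(Ax)_i=\max_j(A_{ij}+x_j)$; composition is the $(\max,+)$ product $(AB)_{ij}=\max_p(A_{ip}+B_{pj})$. Such operators are topical (isotone and $A(x+a\mathbf 1)=Ax+a\mathbf 1$, $\mathbf 1=(1,\dots,1)'$); $Top_d$ is the set of all topical operators on $\mathbb R^d$. Let $\bar x$ be the class of $x$ modulo $\mathbb R\mathbf 1$. A topical operator $A$ has rank 1 if $\overline{Ax}$ does not depend on $x$; the sequence has the memory loss property if some $A(N)\cdots A(1)$ has rank 1 with positive probability. $A(1)0$ is the image of the zero vector. $S_A$ is the support of the law of $A(1)$ and $T_A$ the semigroup it generates. The sequence is algebraically arithmetic if there are $a,b\in\mathbb R$ and $\theta\in Top_d$ of rank 1 such that for all $A\in S_A$ and all $\theta'\in T_A$ of rank 1, $(\theta A\theta'-\theta\theta')(\mathbb R^d)\subset(a+b\mathbb Z)\mathbf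 1$. The graph $\mathcal G(B)$ has nodes $1,\dots,d$ and arcs $(i,j)$ with weight $B_{ij}$ whenever $B_{ij}>-\infty$; it is strongly connected if every node can be reached from every other. $\rho_{\max}(B)$ is the maximum over elementary circuits $(i_1,\dots,i_n,i_1)$ of $\mathcal G(B)$ of the average weight $\frac1n\sum_{j=1}^nB_{i_ji_{j+1}}$. *)

(* Defs.v *)
From HB Require Import structures.
From mathcomp Require Import all_boot all_order all_algebra.
From mathcomp Require Import all_classical all_reals all_analysis measurable_realfun.
Set Implicit Arguments. Unset Strict Implicit. Unset Printing Implicit Defensive.
Import Order.TTheory GRing.Theory Num.Theory.
Local Open Scope classical_set_scope.
Local Open Scope ring_scope.

Section MaxPlus.
Variables (R : realType) (d : nat).

Definition vec := 'I_d -> R.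
Definition op_t := vec -> vec.

Definition is_Rmax_mx (B : 'M[\bar R]_d) : Prop :=
  forall i j, B i j != +oo%E.

Definition is_maxplus_mx (B : 'M[\bar R]_d) : Prop :=
  is_Rmax_mx B /\ forall i, exists j, B i j != -oo%E.

Definition mp_op (B : 'M[\bar R]_d) : op_t :=
  fun x i => fine (\big[maxe/-oo%E]_(j < d) (B i j + (x j)%:E)%E).

Definition cst (a : R) : vec := fun _ => a.
Definition vadd (x y : vec) : vec := fun i => x i + y i.
Definition vsub (x y : vec) : vec := fun i => x i - y i.

Definition topical (f : op_t) : Prop :=
  (forall x y : vec, (forall i, x i <= y i) -> forall i, f x i <= f y i) /\
  (forall (x : vec) (a : R), f (vadd x (cst a)) = vadd (f x) (cst a)).

Definition rank1 (f : op_t) : Prop :=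
  forall x y : vec, exists c : R, f y = vadd (f x) (cst c).

Definition supnorm (x : vec) : R := \big[Num.max/0]_(i < d) `|x i|.

Definition vzero : vec := cst 0.

(* exp chart of R_max, identifying R_max with [0,+oo) (standard topology) *)
Definition expmax (x : \bar R) : R :=
  match x with EFin r => expR r | _ => 0 end.

Definition arc (B : 'M[\bar R]_d) : rel 'I_d := fun i j => B i j != -oo%E.

Definition strongly_connected (B : 'M[\bar R]_d) : Prop :=
  forall i j : 'I_d, connect (arc B) i j.

(* elementary circuit (i_1,...,i_n,i_1), n >= 1, given by the tuple of its
   distinct nodes *)
Definition is_circuit (B : 'M[\bar R]_d) n (t : n.+1.-tuple 'I_d) : bool :=
  uniq t && cycle (arc B) t.

Definition circ_weight (B : 'M[\bar R]_d) n (t : n.+1.-tuple 'I_d) : \bar R :=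
  (\sum_(k < n.+1) B (tnth t k) (tnth t (inord ((k.+1) %% n.+1))))%E.

(* rho_max(B): maximum average weight of elementary circuits
   (-oo if there is no circuit) *)
Definition rho_max (B : 'M[\bar R]_d) : \bar R :=
  (\big[maxe/-oo]_(n < d)
     \big[maxe/-oo]_(t : n.+1.-tuple 'I_d | is_circuit B t)
        (circ_weight B t * ((n.+1)%:R^-1)%:E))%E.

(* composition A(N) ... A(1) applied as operators: the product of the list
   [A(1); ...; A(N)] *)
Definition comp_list (l : seq 'M[\bar R]_d) : op_t :=
  foldl (fun f B => mp_op B \o f) id l.

End MaxPlus.

Section Random.
Variables (R : realType) (d : nat) (dm : measure_display) (Omega : measurableType dm)
  (P : probability Omega R).

Definition mx_measurable : set (set 'M[\bar R]_d) :=
  <<s [set S | exists (i j : 'I_d) (C : set (\bar R)),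
                 measurable C /\ S = [set M : 'M[\bar R]_d | C (M i j)]] >>.

Definition random_mx (X : Omega -> 'M[\bar R]_d) : Prop :=
  forall i j, measurable_fun setT (fun w => X w i j).

Definition random_vec (X : Omega -> vec R d) : Prop :=
  forall i, measurable_fun setT (fun w => X w i).

Definition mutually_independent (A : nat -> Omega -> 'M[\bar R]_d) : Prop :=
  forall (s : seq nat) (S : nat -> set 'M[\bar R]_d),
    uniq s -> (forall n, mx_measurable (S n)) ->
    P (\bigcap_(n in [set` s]) (A n @^-1` S n)) =
    (\prod_(n <- s) P (A n @^-1` S n))%E.

Definition ident_distr (A : nat -> Omega -> 'M[\bar R]_d) : Prop :=
  forall n (S : set 'M[\bar R]_d), mx_measurable S ->
    P (A n @^-1` S) = P (A 0 @^-1` S).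

Definition iid (A : nat -> Omega -> 'M[\bar R]_d) : Prop :=
  (forall n, random_mx (A n)) /\ mutually_independent A /\ ident_distr A.

Definition sigma_seq (A : nat -> Omega -> 'M[\bar R]_d) : set (set Omega) :=
  <<s [set E | exists n (S : set 'M[\bar R]_d),
                 mx_measurable S /\ E = A n @^-1` S] >>.

Definition sigma_vec (X : Omega -> vec R d) : set (set Omega) :=
  <<s [set E | exists (k : 'I_d) (C : set R),
                 measurable C /\ E = [set w | C (X w k)]] >>.

Definition indep_sigma (F G : set (set Omega)) : Prop :=
  forall E E', F E -> G E' -> P (E `&` E') = (P E * P E')%E.

Definition Linfty_vec (X : Omega -> vec R d) : Prop :=
  random_vec X /\ exists M : R, {ae P, forall w, forall k, `|X w k| <= M}.

Definition memory_loss (A : nat -> Omega -> 'M[\bar R]_d) : Prop :=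
  exists N : nat, (0 < P [set w | rank1 (comp_list [seq A n w | n <- iota 0%N N.+1])])%E.

(* support S_A of the law of A(1) (= A 0), in the space of (max,+) matrices
   with the standard topology of R_max (charted by exp) *)
Definition supp (A : nat -> Omega -> 'M[\bar R]_d) : set 'M[\bar R]_d :=
  [set B | is_maxplus_mx B /\
     forall e : R, 0 < e ->
       (0 < P [set w | forall i j, (`|expmax (A 0%N w i j) - expmax (B i j)| < e)%R])%E].

Definition semigrp (A : nat -> Omega -> 'M[\bar R]_d) : set (op_t R d) :=
  [set f | exists l : seq 'M[\bar R]_d,
     l != [::] /\ (forall B, B \in l -> supp A B) /\ f = comp_list l].

Definition alg_arithmetic (A : nat -> Omega -> 'M[\bar R]_d) : Prop :=
  exists (a b : R) (theta : op_t R d),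
    topical theta /\ rank1 theta /\
    forall B, supp A B -> forall theta', semigrp A theta' -> rank1 theta' ->
      forall x : vec R d, exists k : int,
        vsub (theta (mp_op B (theta' x))) (theta (theta' x)) = (cst (a + b * k%:~R) : vec R d).

End Random.

(* Main.v *)
(** Let [B] be a strongly connected matrix of the support, [rho] its maximal
    circuit mean and [c = d!].  Memory loss provides a rank 1 element [theta'] of
    the semigroup, because almost surely all [A n] lie in the support.  All
    [B^m theta'] are again of rank 1, so for [x = theta' 0] and a coordinate [phi]
    of [theta], arithmeticity gives [phi (B^(m+1) x) - phi (B^m x) \in a + bZ],
    hence [phi (B^(m+c) x) - phi (B^m x) \in ca + bZ].

    Put [y_m = B^m x - m rho].  Each coordinate of [y_m] is the weight of an
    optimal walk of length [m], for weights under which all circuits are [<= 0].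
    For large [m] such a walk meets a circuit of weight [0], since otherwise its
    weight tends linearly to [-oo] whereas [y_m] is bounded.  The length of that
    circuit divides [c], so repeating it shows [y_m <= y_(m+c)].  Thus
    [phi (y_(m+c)) - phi (y_m)] is nonnegative with bounded sums and stays in
    [c (a - rho) + bZ]; this forces [0] to be in [c (a - rho) + bZ], that is
    [rho \in a + (b / c) Z]. *)
Require Import Defs.
From HB Require Import structures.
From mathcomp Require Import all_boot all_order all_algebra.
From mathcomp Require Import all_classical all_reals all_analysis measurable_realfun.
From mathcomp Require Import zify ring lra.
Import Order.TTheory GRing.Theory Num.Theory.
Local Open Scope classical_set_scope.
Local Open Scope ring_scope.

(** * Weighted walks in a finite graph *)

Fixpoint walk_weight {R : realType} {T : Type} (W : T -> T -> R) x p : R :=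
  if p is y :: q then W x y + walk_weight W y q else 0.

Section Walks.
Context {R : realType} {T : finType}.
Implicit Types (e : rel T) (W : T -> T -> R) (x y z : T) (p q : seq T).

Lemma walk_weight_cat W x p q :
  walk_weight W x (p ++ q) = walk_weight W x p + walk_weight W (last x p) q.
Proof. by elim: p x => [|y p IH] x /=; rewrite ?add0r // IH addrA. Qed.

Lemma walk_weightD W (c : R) x p :
  walk_weight (fun i j => W i j + c) x p = walk_weight W x p + (size p)%:R * c.
Proof.
elim: p x => [|y p IH] x /=; first by rewrite mul0r addr0.
by rewrite IH -natr1; ring.
Qed.

Lemma not_uniq_split p :
  ~~ uniq p -> exists y p1 p2 p3, p = p1 ++ y :: p2 ++ y :: p3.
Proof.
elim: p => //= x p IH; rewrite negb_and negbK => /orP[/splitPr[p2 p3]|].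
  by exists x, [::], p2, p3.
by move=> /IH[y [p1 [p2 [p3 ->]]]]; exists y, (x :: p1), p2, p3.
Qed.

(** The stretch between two visits of a repeated node [y] is a closed walk; cutting it out leaves
    the endpoints unchanged. Both pieces are strictly shorter, which drives the inductions below. *)
Lemma remove_loop e W x p : path e x p -> ~~ uniq p ->
  exists y q p', [/\ path e y q, last y q = y, path e x p' & last x p' = last x p] /\
    [/\ walk_weight W x p = walk_weight W y q + walk_weight W x p',
     (size q < size p)%N & (size p' < size p)%N].
Proof.
move=> ep /not_uniq_split[y [p1 [p2 [p3 pE]]]]; subst p.
exists y, (rcons p2 y), (p1 ++ y :: p3).
move: ep; rewrite !cat_path /= !cat_path /= rcons_path last_rcons.
move=> /and5P[-> -> -> -> ->]; split; first by split => //; rewrite !last_cat /= last_cat.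
split.
- rewrite -cats1 !walk_weight_cat /= !walk_weight_cat /=; ring.
- by rewrite size_rcons !size_cat /= size_cat /=; lia.
- by rewrite !size_cat /= size_cat /=; lia.
Qed.

(** A walk lists the nodes after its start, so a closed walk with [uniq q] is an elementary circuit
    or empty. *)
Definition nonpos_circuits e W := forall x q,
  path e x q -> last x q = x -> uniq q -> walk_weight W x q <= 0.

Lemma closed_walk_le0 e W x q : nonpos_circuits e W ->
  path e x q -> last x q = x -> walk_weight W x q <= 0.
Proof.
move=> He; have [n] := ubnP (size q); elim: n x q => // n IH x q /ltnSE sq eq lq.
have [/He->//|/(remove_loop _ W _ _ eq)] := boolP (uniq q).
move=> [y [q1 [q2 [[eq1 lq1 eq2 lq2] [-> s1 s2]]]]].
by rewrite -[leRHS]addr0 lerD //; apply: IH => //; [lia|lia|rewrite lq2].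
Qed.

(** Removing loops, which weigh at most 0, never lowers the weight, and a walk without repetition
    has at most [#|T|] arcs. *)
Lemma walk_weight_bounded e W : nonpos_circuits e W ->
  exists K, forall x p, path e x p -> walk_weight W x p <= K.
Proof.
move=> He; pose M := \sum_(i : T) \sum_(j : T) `|W i j|.
have WM i j : W i j <= M.
  apply: le_trans (ler_norm _) _; rewrite /M (bigD1 i) //= (bigD1 j) //= -addrA lerDl.
  by rewrite addr_ge0 ?sumr_ge0 // => k _; rewrite sumr_ge0.
have M0 : 0 <= M by rewrite sumr_ge0 // => k _; rewrite sumr_ge0.
exists (#|T|%:R * M) => x p.
have [n] := ubnP (size p); elim: n p => // n IH p /ltnSE sp ep.
have [up|/(remove_loop _ W _ _ ep)] := boolP (uniq p).
  apply: (@le_trans _ _ ((size p)%:R * M)).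
    elim: p x {sp ep up IH} => [|y p IHp] x /=; first by rewrite mul0r.
    by rewrite -natr1 mulrDl mul1r addrC lerD.
  by rewrite ler_wpM2r // ler_nat -(card_uniqP up) max_card.
move=> [y [q1 [q2 [[eq1 lq1 eq2 lq2] [-> s1 s2]]]]].
rewrite -[leRHS]add0r lerD //; first exact: (closed_walk_le0 _ _ _ _ He).
by apply: IH => //; lia.
Qed.

(** Only finitely many pairs [(x, q)] have [q] duplicate-free, so the negative values stay away from
    0. *)
Lemma uniq_weight_gap (f : T -> seq T -> R) : exists2 dl : R, 0 < dl &
  forall x q, uniq q -> f x q < 0 -> f x q <= - dl.
Proof.
pose s := [seq (x, q) | x <- enum T,
  q <- flatten [seq map val (enum {: n.-tuple T}) | n <- iota 0 #|T|.+1]].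
have sP x q : uniq q -> (x, q) \in s.
  move=> uq; apply/allpairsP; exists (x, q); split; [by rewrite mem_enum| |by []].
  apply/flattenP; exists (map val (enum {: (size q).-tuple T})); last first.
    by apply/mapP; exists (in_tuple q); rewrite ?mem_enum.
  apply/mapP; exists (size q) => //; rewrite mem_iota /= add0n ltnS.
  by rewrite -(card_uniqP uq) max_card.
suff [dl d0 H] : exists2 dl : R, 0 < dl &
    forall xq, xq \in s -> f xq.1 xq.2 < 0 -> f xq.1 xq.2 <= - dl.
  by exists dl => // x q uq; exact: (H (x, q) (sP _ _ uq)).
elim: {sP}s => [|a s [dl d0 IH]]; first by exists 1.
have [fa|fa] := ltP (f a.1 a.2) 0; last first.
  exists dl => // xq; rewrite inE => /orP[/eqP->|]; last exact: IH.
  by rewrite ltNge fa.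
exists (Num.min dl (- f a.1 a.2)); first by rewrite lt_min d0 oppr_gt0.
move=> xq; rewrite inE => /orP[/eqP-> _|xs f0]; rewrite lerNr ge_min.
  by rewrite lexx orbT.
by rewrite lerNr IH.
Qed.

End Walks.

(** * Iterates of a max-plus operator and critical nodes *)

(* [F] is the max-plus operator of the weighted graph [(e, W)]. *)
Section Iterates.
Context {R : realType} {T : finType} {e : rel T} {W : T -> T -> R}
  {F : (T -> R) -> T -> R}.
Hypothesis Fge : forall x i j, e i j -> W i j + x j <= F x i.
Hypothesis Fattained : forall x i, exists2 j, e i j & F x i = W i j + x j.
Hypothesis circuits : nonpos_circuits e W.
Hypothesis connected : forall i j, connect e i j.

(** When all circuits weigh at most 0, these are the nodes of the critical graph of max-plus
    spectral theory, if that graph is nonempty. *)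
Definition critical i := exists q,
  [/\ path e i q, last i q = i, uniq q, q != [::] & walk_weight W i q = 0].

Lemma iter_ge_walk x i p m : path e i p ->
  walk_weight W i p + iter m F x (last i p) <= iter (size p + m) F x i.
Proof.
elim: p i => [|j p IH] i /=; first by rewrite add0r.
move=> /andP[eij ep]; apply: le_trans (Fge _ _ _ eij).
by rewrite -addrA lerD2l IH.
Qed.

Lemma iter_optimal_walk x i m : exists p,
  [/\ path e i p, size p = m & iter m F x i = walk_weight W i p + x (last i p)].
Proof.
elim: m i => [|m IH] i; first by exists [::]; rewrite /= add0r.
have [j eij Fij] := Fattained (iter m F x) i.
have [p [ep sp pE]] := IH j; exists (j :: p) => /=.
by rewrite eij ep sp Fij pE addrA.
Qed.

(** The zero circuit has at most [#|T|] arcs, so its length divides the factorial, and running round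
    it first costs nothing. *)
Lemma critical_monotone x i m : critical i ->
  iter m F x i <= iter ((#|T|)`! + m) F x i.
Proof.
move=> [q [eq lq uq q0 w0]].
have /dvdnP[k ->] : (size q %| (#|T|)`!)%N.
  by apply: dvdn_fact; rewrite lt0n size_eq0 q0 -(card_uniqP uq) max_card.
elim: k => [|k IH]; first by rewrite mul0n.
rewrite mulSn -addnA; apply: le_trans IH _.
by have := iter_ge_walk x _ _ (k * size q + m) eq; rewrite w0 lq add0r.
Qed.

Lemma finfun_ub (f : T -> R) : exists K, forall i, f i <= K.
Proof.
exists (\sum_j `|f j|) => i; apply: le_trans (ler_norm _) _.
by rewrite (bigD1 i) //= lerDl sumr_ge0.
Qed.

Lemma iter_ub x : exists K, forall m i, iter m F x i <= K.
Proof.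
have [K HK] := walk_weight_bounded _ _ circuits; have [K' HK'] := finfun_ub x.
exists (K + K') => m i; have [p [ep _ ->]] := iter_optimal_walk x i m.
by rewrite lerD // HK.
Qed.

(** At [i0] the iterates do not decrease along residue classes modulo [c], so the first [c] values
    bound them below. A fixed walk to [i0] carries the bound to any other node once [m] reaches its
    length. *)
Lemma iter_lb x i0 : critical i0 ->
  exists K N, forall m i, (N <= m)%N -> K <= iter m F x i.
Proof.
move=> ci0.
have [K0 HK0] : exists K, forall m, K <= iter m F x i0.
  pose c := (#|T|)`!; have c0 : (0 < c)%N by exact: fact_gt0.
  have mono k r : iter r F x i0 <= iter (k * c + r) F x i0.
    elim: k => [|k IH]; first by rewrite mul0n.
    by rewrite mulSn -addnA (le_trans IH) // critical_monotone.
  exists (- \sum_(r < c) `|iter r F x i0|) => m.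
  rewrite [in leRHS](divn_eq m c); apply: le_trans (mono _ _).
  rewrite lerNl (bigD1 (Ordinal (ltn_pmod m c0))) //= ler_wpDr ?sumr_ge0 //.
  by rewrite -normrN ler_norm.
have Hi i : exists KN : R * nat, forall m, (KN.2 <= m)%N -> KN.1 <= iter m F x i.
  have /connectP[p ep lp] := connected i i0.
  exists (walk_weight W i p + K0, size p) => m /= /subnKC <-.
  by apply: le_trans (iter_ge_walk _ _ _ _ ep); rewrite lerD2l -lp.
have [g Hg] := choice Hi.
have [K HK] := finfun_ub (fun i => - (g i).1).
exists (- K), (\max_i (g i).2) => m i mi.
apply: (@le_trans _ _ (g i).1); first by rewrite lerNl HK.
by apply: Hg; apply: leq_trans mi; exact: (leq_bigmax i).
Qed.

(** Among noncritical nodes every nonempty elementary circuit weighs at most [- g]. Circuits thus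
    stay nonpositive after adding a small [dl] to each arc, and the uniform bound for the raised
    weights gives the linear decay. *)
Lemma noncritical_walk_weight : exists K, exists2 dl : R, 0 < dl &
  forall i p, path e i p -> (forall j, j \in i :: p -> ~ critical j) ->
    walk_weight W i p <= K - (size p)%:R * dl.
Proof.
pose e' : rel T := fun i j => [&& e i j, `[< ~ critical i >] & `[< ~ critical j >]].
have e'e i p : path e' i p -> path e i p by apply: sub_path => ? ? /and3P[].
have [g g0 Hg] := uniq_weight_gap (walk_weight W).
(* An elementary circuit has at most [#|T|] arcs, so raising each by [dl] adds at most [g]. *)
pose dl := g / #|T|.+1%:R.
have dl0 : 0 < dl by rewrite divr_gt0 // ltr0n.
have H : nonpos_circuits e' (fun i j => W i j + dl).
  move=> i q eq lq uq; rewrite walk_weightD.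
  have [->|q0] := eqVneq q [::]; first by rewrite /= mul0r addr0.
  have ci : ~ critical i.
    by case: q q0 eq {lq uq} => //= j q _ /andP[/and3P[_ /asboolP]].
  have wq : walk_weight W i q < 0.
    rewrite lt_neqAle circuits ?e'e // andbT; apply/eqP => w0.
    by apply: ci; exists q; split => //; exact: e'e.
  have := Hg i q uq wq; suff : (size q)%:R * dl <= g by lra.
  rewrite /dl mulrA ler_pdivrMr ?ltr0n // mulrC ler_pM2l // ler_nat.
  by rewrite ltnW // ltnS -(card_uniqP uq) max_card.
have [K HK] := walk_weight_bounded _ _ H.
exists K, dl => // i p ep cp; rewrite lerBrDr -walk_weightD; apply: HK.
elim: p i ep cp => //= j p IH i /andP[eij ep] cp; apply/andP; split.
  by apply/and3P; split=> //; apply/asboolP; apply: cp; rewrite !inE eqxx ?orbT.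
by apply: IH => // k kp; apply: cp; rewrite inE kp orbT.
Qed.

Lemma iter_eventually_monotone x i0 : critical i0 -> exists N, forall m i,
  (N <= m)%N -> iter m F x i <= iter ((#|T|)`! + m) F x i.
Proof.
move=> ci0; have [L [N1 HL]] := iter_lb x _ ci0.
have [K [dl dl0 HK]] := noncritical_walk_weight; have [X HX] := finfun_ub x.
(* From [N2] on, [K + X - m * dl] lies below the lower bound [L], which excludes optimal walks
   avoiding critical nodes. *)
pose N2 := `|Num.ceil ((K + X - L) / dl)|%N.+1.
exists (maxn N1 N2) => m i; rewrite geq_max => /andP[N1m N2m].
have [p [ep sp pE]] := iter_optimal_walk x i m.
have [[z [zp cz]]|nc] := pselect (exists z, z \in i :: p /\ critical z).
  (* The optimal walk is cut at the critical node [z], and the extra [#|T|!] steps are inserted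
     there. *)
  rewrite pE; move: sp ep pE; case/splitPl: zp => p1 p2 lp1 sp ep _.
  move: ep; rewrite cat_path lp1 => /andP[ep1 ep2].
  rewrite walk_weight_cat last_cat lp1 -sp size_cat addnCA -addrA.
  apply: le_trans (iter_ge_walk _ _ _ _ ep1); rewrite lerD2l lp1.
  apply: le_trans (critical_monotone _ _ _ cz).
  by have := iter_ge_walk x _ _ 0 ep2; rewrite addn0.
have : iter m F x i < L.
  rewrite pE; have := HX (last i p).
  have /(HK _ _ ep) : forall j, j \in i :: p -> ~ critical j.
    by move=> j jp cj; apply: nc; exists j.
  rewrite sp; suff : K + X - L < m%:R * dl by lra.
  rewrite -ltr_pdivrMr // (@lt_le_trans _ _ N2%:R) ?ler_nat //.
  rewrite /N2 -natr1; set t := _ / dl.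
  apply: (@le_lt_trans _ _ (`|Num.ceil t|%N)%:R); last by rewrite ltrDl.
  apply: le_trans (ceil_ge t) _; rewrite natr_absz ler_int; exact: ler_norm.
by move=> /(le_lt_trans (HL m i N1m)); rewrite ltxx.
Qed.

End Iterates.

(** * Max-plus matrices and their circuit means *)

Lemma walk_weightE {R : realType} {T : Type} (W : T -> T -> R) x0 x q :
  walk_weight W x q = \sum_(k < size q) W (nth x0 (x :: q) k) (nth x0 q k).
Proof.
elim: q x => [|y q IH] x /=; first by rewrite big_ord0.
by rewrite big_ord_recl /= IH.
Qed.

Section MaxPlusMatrix.
Context {R : realType} {d : nat} {B : 'M[\bar R]_d}.
Hypothesis mpB : is_maxplus_mx B.

Lemma arc_fineK i j : Defs.arc B i j -> (fine (B i j))%:E = B i j.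
Proof. by move=> Bij; rewrite fineK // fin_numE (proj1 mpB) andbT. Qed.

Lemma mp_op_arc (x : vec R d) i :
  exists2 j, Defs.arc B i j & mp_op B x i = fine (B i j) + x j.
Proof.
have [j Bij] := mpB.2 i.
have [k _] := eq_bigmax (x := -oo%E) j xpredT (fun j => (B i j + (x j)%:E)%E) isT
  (fun k _ => leNye _).
rewrite /mp_op => Ek; rewrite Ek.
(* If the maximizing entry were [-oo], so would be the whole row, against the finite entry at
   [j]. *)
have Bik : Defs.arc B i k.
  apply/eqP => Bik; have := le_bigmax -oo%E (fun j => (B i j + (x j)%:E)%E) j.
  by rewrite Ek Bik addNye leeNy_eq -(arc_fineK _ _ Bij).
by exists k; rewrite // -(arc_fineK _ _ Bik).
Qed.

Lemma mp_op_ge (x : vec R d) i j : Defs.arc B i j -> fine (B i j) + x j <= mp_op B x i.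
Proof.
move=> Bij; have := le_bigmax -oo%E (fun j => (B i j + (x j)%:E)%E) j.
have [k _] := eq_bigmax (x := -oo%E) j xpredT (fun j => (B i j + (x j)%:E)%E) isT
  (fun k _ => leNye _).
rewrite /mp_op => ->; rewrite -(arc_fineK _ _ Bij).
case: (B i k) (mpB.1 i k) => //=.
Qed.

Lemma mp_op_topical : topical (mp_op B).
Proof.
split=> [x y xy i|x a].
  have [j Bij ->] := mp_op_arc x i.
  by apply: le_trans (mp_op_ge _ _ _ Bij); rewrite lerD2l.
have le z c i : mp_op B (vadd z (Defs.cst c)) i <= mp_op B z i + c.
  have [j Bij ->] := mp_op_arc (vadd z (Defs.cst c)) i.
  by rewrite /vadd /Defs.cst addrA lerD2r mp_op_ge.
apply/funext => i; apply/eqP; rewrite eq_le le /= /vadd /Defs.cst -lerBrDr.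
(* The reverse inequality is [le] for the shifted vector with [- a]. *)
apply: le_trans (le _ (- a) i).
rewrite (_ : vadd _ _ = x) //; by apply/funext => j; rewrite /vadd /Defs.cst addrK.
Qed.

Lemma iter_mp_op_shift (r : R) m (x : vec R d) i :
  iter m (fun y : vec R d => vsub (mp_op B y) (Defs.cst r)) x i
  = iter m (mp_op B) x i - m%:R * r.
Proof.
elim: m i => [|m IH] i /=; first by rewrite mul0r subr0.
rewrite (_ : iter m _ x = vadd (iter m (mp_op B) x) (Defs.cst (- (m%:R * r)))).
  by rewrite mp_op_topical.2 /vsub /vadd /Defs.cst -natr1; ring.
by apply/funext => j; rewrite IH.
Qed.

Lemma circ_weightE n (t : n.+1.-tuple 'I_d) x p : tval t = x :: p ->
  cycle (Defs.arc B) (x :: p) ->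
  circ_weight B t = (walk_weight (fun i j => fine (B i j)) x (rcons p x))%:E.
Proof.
move=> tE cp; have sp : size p = n by have := size_tuple t; rewrite tE => -[].
rewrite (walk_weightE _ x) size_rcons sp -sumEFin; apply: eq_bigr => k _.
have kn : (k < n.+1)%N := ltn_ord k.
rewrite !(tnth_nth x) inordK ?ltn_pmod // tE.
have -> : nth x (x :: p) k = nth x (x :: rcons p x) k.
  by rewrite -rcons_cons nth_rcons /= sp kn.
(* The cyclic index wraps to 0 exactly at [k = n], where the closed walk has its final [x]. *)
have -> : nth x (x :: p) (k.+1 %% n.+1) = nth x (rcons p x) k.
  rewrite nth_rcons sp; have [kn'|kn'] := ltnP k n; first by rewrite modn_small.
  have -> : nat_of_ord k = n by apply/eqP; rewrite eqn_leq kn' -ltnS kn.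
  by rewrite modnn eqxx.
by rewrite arc_fineK //; apply/(pathP x) => //; rewrite size_rcons sp.
Qed.

Lemma circ_weight_walk n (t : n.+1.-tuple 'I_d) : is_circuit B t ->
  exists x q, [/\ path (Defs.arc B) x q, last x q = x, uniq q, size q = n.+1 &
    circ_weight B t = (walk_weight (fun i j => fine (B i j)) x q)%:E].
Proof.
case/tupleP: t => x p /andP[up cp]; exists x, (rcons p x); split=> //.
- by rewrite last_rcons.
- by rewrite rcons_uniq.
- by rewrite size_rcons size_tuple.
- exact: circ_weightE.
Qed.

Lemma walk_circ_weight x q : path (Defs.arc B) x q -> last x q = x -> uniq q ->
  q != [::] -> exists n (t : n.+1.-tuple 'I_d),
    [/\ (n < d)%N, is_circuit B t, size q = n.+1 &
     circ_weight B t = (walk_weight (fun i j => fine (B i j)) x q)%:E].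
Proof.
case/lastP: q => // q y; rewrite last_rcons => pq yx uq _; subst y.
have ct : is_circuit B [tuple of x :: in_tuple q].
  by rewrite /is_circuit /= -rcons_uniq uq.
exists (size q), [tuple of x :: in_tuple q]; split=> //.
- by have := max_card (mem (rcons q x)); rewrite (card_uniqP uq) size_rcons card_ord.
- by rewrite size_rcons.
- exact: circ_weightE.
Qed.

(** Subtracting the maximal mean from every arc puts [B] in the setting of the iterates: no circuit
    is positive, and the maximizing one weighs 0. *)
Lemma rho_max_critical : (0 < d)%N -> strongly_connected B ->
  exists rho : R, [/\ rho_max B = rho%:E,
    nonpos_circuits (Defs.arc B) (fun i j => fine (B i j) - rho) &
    exists i, @critical R _ (Defs.arc B) (fun i j => fine (B i j) - rho) i].
Proof.
move=> d0 scB.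
pose mean n (t : n.+1.-tuple 'I_d) := (circ_weight B t * ((n.+1)%:R^-1)%:E)%E.
(* An arc from [i] to [j] and a duplicate-free walk back form an elementary circuit. *)
have [n0 [t0 [n0d ct0]]] : exists n (t : n.+1.-tuple 'I_d), (n < d)%N /\ is_circuit B t.
  have [j Bij] := mpB.2 (Ordinal d0); set i := Ordinal d0 in Bij.
  have /connectP[p] := scB j i; case/shortenP => q pq uq _ lq.
  have pc : path (Defs.arc B) j (rcons q j) by rewrite rcons_path pq -lq.
  have uc : uniq (rcons q j) by rewrite rcons_uniq.
  have [||n [t [nd ct _ _]]] := walk_circ_weight _ _ pc _ uc.
  - by rewrite last_rcons.
  - by case: (q).
  - by exists n, t.
have meanfin n (t : n.+1.-tuple 'I_d) : is_circuit B t -> mean n t = (fine (mean n t))%:E.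
  by move=> /circ_weight_walk[x [q [_ _ _ _ wE]]]; rewrite /mean wE.
have mean_le n (t : n.+1.-tuple 'I_d) : (n < d)%N -> is_circuit B t ->
    (mean n t <= rho_max B)%E.
  move=> nd ct; rewrite /rho_max; apply: (bigmax_sup (Ordinal nd)) => //=.
  exact: le_bigmax_cond.
have [n [t [nd ct rhoE]]] : exists n (t : n.+1.-tuple 'I_d),
    [/\ (n < d)%N, is_circuit B t & rho_max B = mean n t].
  have [m _] := eq_bigmax (x := -oo%E) (Ordinal n0d) xpredT
    (fun n : 'I_d => \big[maxe/-oo]_(t : n.+1.-tuple 'I_d | is_circuit B t) mean n t)%E
    isT (fun _ _ => leNye _).
  rewrite -/(rho_max B) => rhoE.
  have [[t ct]|nt] := pselect (exists t : m.+1.-tuple 'I_d, is_circuit B t).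
    have [u cu uE] := eq_bigmax (x := -oo%E) t (is_circuit B (n := m)) (mean m) ct
      (fun _ _ => leNye _).
    by exists m, u; rewrite rhoE uE.
  (* Without circuits of the maximizing length the maximum would be [-oo], below the finite mean of
     [t0]. *)
  have := mean_le _ _ n0d ct0.
  rewrite rhoE big_pred0 => [|u]; last by apply/negbTE/negP => cu; apply: nt; exists u.
  by rewrite (meanfin _ _ ct0).
have [x [q [pq lq uq sq wE]]] := circ_weight_walk _ _ ct.
pose rho := fine (mean n t); exists rho; rewrite rhoE; split.
- exact: meanfin.
- move=> y p pp lp up; have [->|p0] := eqVneq p [::]; first by [].
  rewrite walk_weightD mulrN subr_le0.
  have [m [u [md cu sp uE]]] := walk_circ_weight _ _ pp lp up p0.
  have := mean_le _ _ md cu; rewrite rhoE (meanfin _ _ ct) -/rho /mean uE -EFinM lee_fin.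
  by rewrite ler_pdivrMr ?ltr0n // mulrC sp.
exists x, q; split=> //; first by rewrite -size_eq0 sq.
rewrite walk_weightD mulrN; apply/eqP; rewrite subr_eq0 /rho /mean wE /= sq.
by rewrite mulrC divfK // pnatr_eq0.
Qed.

End MaxPlusMatrix.

(** * Bounded monotone sequences with increments in a coset of a lattice *)

(** If 0 is not in [s + bZ], the nonnegative elements of this coset are at least some [r > 0], so
    [u] grows linearly, against its bound. *)
Lemma bounded_lattice_increments {R : realType} (u : nat -> R) (s b K : R) :
  (forall k, exists j : int, u k.+1 - u k = s + b * j%:~R) ->
  (forall k, u k <= u k.+1) -> (forall k, u k <= K) ->
  exists j : int, s + b * j%:~R = 0.
Proof.
move=> us um uK; apply: contrapT => no0.
have {}no0 j : s + b * j%:~R != 0 by apply/eqP => sj; apply: no0; exists j.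
have [r r0 Hr] : exists2 r : R, 0 < r &
    forall j : int, 0 <= s + b * j%:~R -> r <= s + b * j%:~R.
  have [b0|b0] := eqVneq b 0.
    exists `|s|; first by rewrite normr_gt0; have := no0 0; rewrite mulr0 addr0.
    by move=> j; rewrite b0 mul0r addr0 => /ger0_norm->.
  have nb0 : 0 < `|b| by rewrite normr_gt0.
  pose q := Num.floor (s / `|b|).
  have qs : q%:~R * `|b| <= s by rewrite -ler_pdivlMr // floor_le.
  have sq : s < (q + 1)%:~R * `|b| by rewrite -ltr_pdivrMr // floorD1_gt.
  have bE (j : int) : b * (sgz b * j)%:~R = `|b| * j%:~R.
    by rewrite intrM mulrA -sgrEz mulrC (mulrC b) -normrEsg mulrC.
  (* This is the remainder of [s] modulo [|b|], the least nonnegative element of the coset; it is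
     nonzero by [no0]. *)
  exists (s - q%:~R * `|b|).
    rewrite lt_neqAle subr_ge0 qs andbT eq_sym.
    by have := no0 (sgz b * - q); rewrite bE intrN mulrN mulrC.
  move=> j; have -> : b * j%:~R = `|b| * (sgz b * j)%:~R.
    by rewrite -bE mulrA; congr (_ * _%:~R); rewrite mulz_sg b0 mul1r.
  set i := (sgz b * j) => ri.
  have : 0 < (i + q + 1)%:~R * `|b| by move: sq; rewrite !intrD; lra.
  rewrite pmulr_lgt0 // ltr0z ltzD1 -(ler0z R) intrD => iq.
  have : 0 <= (i%:~R + q%:~R) * `|b| by rewrite mulr_ge0.
  by rewrite mulrDl (mulrC i%:~R); lra.
have ub k : u 0 + k%:R * r <= u k.
  elim: k => [|k IH]; first by rewrite mul0r addr0.
  have [j uj] := us k; have := um k; rewrite -subr_ge0 uj => /Hr; rewrite -uj -natr1; lra.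
pose k := `|Num.ceil ((K - u 0) / r)|%N.+1.
have : K - u 0 < k%:R * r.
  rewrite -ltr_pdivrMr // /k -natr1; set t := _ / r.
  apply: (@le_lt_trans _ _ (`|Num.ceil t|%N)%:R); last by rewrite ltrDl.
  apply: le_trans (ceil_ge t) _; rewrite natr_absz ler_int; exact: ler_norm.
by have := ub k; have := uK k; lra.
Qed.

(** * The maximal circuit mean of a single matrix *)

Lemma rho_max_lattice {R : realType} {d : nat} (B : 'M[\bar R]_d)
    (theta : op_t R d) (a b : R) (x : vec R d) :
  is_maxplus_mx B -> strongly_connected B -> (0 < d)%N -> topical theta ->
  (forall m, exists k : int,
    vsub (theta (iter m.+1 (mp_op B) x)) (theta (iter m (mp_op B) x))
    = Defs.cst (a + b * k%:~R)) ->
  exists k : int, rho_max B = (a + b / d`!%:R * k%:~R)%:E.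
Proof.
move=> mpB scB d0 [theta_mono theta_hom] theta_inc.
have [rho [rhoE circ [i0 ci0]]] := rho_max_critical mpB d0 scB.
pose F (y : vec R d) := vsub (mp_op B y) (Defs.cst rho).
have Fge (y : vec R d) i j :
    Defs.arc B i j -> (fine (B i j) - rho) + y j <= F y i.
  by move=> /(mp_op_ge mpB y); rewrite /F /vsub /Defs.cst; lra.
have Fatt (y : vec R d) i :
    exists2 j, Defs.arc B i j & F y i = (fine (B i j) - rho) + y j.
  have [j Bij yE] := mp_op_arc mpB y i; exists j => //.
  by rewrite /F /vsub /Defs.cst yE; ring.
have [N mono] := iter_eventually_monotone Fge Fatt circ scB x i0 ci0.
have [K HK] := iter_ub Fatt circ x.
rewrite card_ord in mono; set c := d`! in mono *.
have c0 : c%:R != 0 :> R by rewrite pnatr_eq0 -lt0n fact_gt0.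
pose g m := theta (iter m (mp_op B) x) i0.
have gF m : theta (iter m F x) i0 = g m - m%:R * rho.
  rewrite (_ : iter m F x = vadd (iter m (mp_op B) x) (Defs.cst (- (m%:R * rho)))).
    by rewrite theta_hom.
  by apply/funext => j; rewrite (iter_mp_op_shift mpB).
have ginc n m : exists j : int, g (n + m)%N - g m = n%:R * a + b * j%:~R.
  elim: n => [|n [j IH]]; first by exists 0; rewrite subrr mul0r mulr0 addr0.
  have [k /(congr1 (fun f : vec R d => f i0)) Hk] := theta_inc (n + m)%N.
  have {}Hk : g (n.+1 + m)%N - g (n + m)%N = a + b * k%:~R := Hk.
  by exists (j + k); rewrite intrD -natr1; lra.
(* Sampling every [c] steps from [N] on makes the normalized orbit monotone, and isotony of [theta]
   transfers this to [u]. *)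
pose u k := theta (iter (k * c + N)%N F x) i0.
have [||| j Hj] := bounded_lattice_increments u (c%:R * a - c%:R * rho) b
    (theta (vadd (@vzero R d) (Defs.cst K)) i0).
- move=> k; have [j Hj] := ginc c (k * c + N)%N.
  exists j; rewrite /u !gF mulSn -addnA natrD; lra.
- move=> k; apply: theta_mono => i; rewrite mulSn -addnA; apply: mono.
  exact: leq_addl.
- by move=> k; apply: theta_mono => i; rewrite /vadd /vzero /Defs.cst add0r HK.
(* Here [c * a - c * rho + b * j = 0], which is divided by [c]. *)
exists j; rewrite rhoE; congr EFin; apply: (mulfI c0); rewrite mulrDr.
rewrite mulrA (mulrCA c%:R) divff //; lra.
Qed.

(** * Products of matrices and a countable test for rank 1 *)

Lemma comp_list_rcons {R : realType} {d : nat} (l : seq 'M[\bar R]_d) B :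
  comp_list (rcons l B) = mp_op B \o comp_list l.
Proof. by rewrite /comp_list foldl_rcons. Qed.

Lemma comp_list_topical {R : realType} {d : nat} (l : seq 'M[\bar R]_d) :
  (forall B, B \in l -> is_maxplus_mx B) -> topical (comp_list l).
Proof.
elim/last_ind: l => [|l B IH] lB; first by split.
have [|l1 l2] := IH; first by move=> C Cl; apply: lB; rewrite mem_rcons inE Cl orbT.
have [|B1 B2] := @mp_op_topical _ _ B; first by apply: lB; rewrite mem_rcons inE eqxx.
rewrite comp_list_rcons; split=> [x y xy|x a] /=; first exact/B1/l1.
by rewrite l2 B2.
Qed.

(** Rank 1 becomes countably many conditions, as measurability of the rank 1 event requires. Topical
    maps are sup-norm nonexpansive, so rational vectors suffice. *)
Lemma rank1_rational {R : realType} {d : nat} (f : op_t R d) (i0 : 'I_d) :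
  topical f -> rank1 f <-> forall (v : {ffun 'I_d -> rat}) i,
    f (ratr \o v) i - f (ratr \o v) i0 = f (@vzero R d) i - f (@vzero R d) i0.
Proof.
move=> [fmono fhom]; split=> [rf v i|fv].
  by have [c ->] := rf (@vzero R d) (ratr \o v); rewrite /vadd /Defs.cst; ring.
have fx (x : vec R d) i : f x i - f x i0 = f (@vzero R d) i - f (@vzero R d) i0.
  suff H (e : R) : 0 < e ->
      `|(f x i - f x i0) - (f (@vzero R d) i - f (@vzero R d) i0)| <= e.
    apply/eqP; rewrite -subr_eq0 -normr_le0; apply/ler_addgt0Pr => e e0.
    by rewrite add0r H.
  (* A rational [v] between [x] and [x + e] gives [f x <= f v <= f x + e] coordinatewise. *)
  move=> e0; have /choice[v Hv] : forall j, exists q : rat, x j < ratr q < x j + e.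
    move=> j; have [|q] := @rat_in_itvoo R (x j) (x j + e); first by rewrite ltrDl.
    by rewrite in_itv; exists q.
  have lo j : f x j <= f (ratr \o finfun v) j.
    by apply: fmono => k; rewrite /= ffunE; have /andP[/ltW] := Hv k.
  have hi j : f (ratr \o finfun v) j <= f x j + e.
    rewrite -[leRHS]/(vadd (f x) (Defs.cst e) j) -fhom; apply: fmono => k.
    by rewrite /= ffunE; have /andP[_ /ltW] := Hv k.
  rewrite -(fv (finfun v)) ler_distlC.
  by have := lo i; have := lo i0; have := hi i; have := hi i0; lra.
move=> x y; exists (f y i0 - f x i0); apply/funext => i; rewrite /vadd /Defs.cst.
by have := fx x i; have := fx y i; lra.
Qed.

(** * Measurability of balls in the space of matrices *)

Lemma measurable_expmax {R : realType} (C : set R) :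
  measurable C -> measurable (@expmax R @^-1` C).
Proof.
move=> mC.
(* Both infinities are sent to 0, so they enter the preimage exactly when [C 0] holds. *)
have -> : @expmax R @^-1` C = (EFin @` (expR @^-1` C))
    `|` [set x | (x = -oo%E \/ x = +oo%E) /\ C 0].
  apply/seteqP; split=> [[r| |]|x] /=.
  - by move=> Cr; left; exists r.
  - by move=> C0; right; split=> //; right.
  - by move=> C0; right; split=> //; left.
  - by move=> [[r Cr <-]//|[[->|->]]].
apply: measurableU.
  apply: measurable_image_EFin; rewrite -[X in _ X]setTI; exact: measurable_expR.
have [C0|C0] := pselect (C 0).
  rewrite (_ : [set x | _] = [set -oo%E] `|` [set +oo%E]); first exact: measurableU.
  by apply/seteqP; split=> x /=; [case|].
rewrite (_ : [set x | _] = set0) //.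
by apply/seteqP; split=> x //= [].
Qed.

(* Balls with rational data: a countable base of the topology charted by
   [expmax]. *)
Definition rat_ball {R : realType} {d : nat} (k : {ffun 'I_d * 'I_d -> rat} * rat)
    : set 'M[\bar R]_d :=
  [set M | forall i j, `|expmax (M i j) - ratr (k.1 (i, j))| < ratr k.2].

Lemma rat_ball_coord {R : realType} {d : nat} k : @rat_ball R d k =
  \bigcap_(p in [set: 'I_d * 'I_d])
    [set M | (@expmax R @^-1` [set` `]ratr (k.1 p) - ratr k.2, ratr (k.1 p) + ratr k.2[]) (M p.1 p.2)].
Proof.
apply/seteqP; split=> [M MK [i j] _|M MK i j] /=.
  by rewrite in_itv /= -ltr_distl MK.
by have := MK (i, j) I; rewrite /= in_itv /= -ltr_distl.
Qed.

Lemma rat_ball_measurable {R : realType} {d : nat} k :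
  mx_measurable (@rat_ball R d k).
Proof.
rewrite rat_ball_coord /mx_measurable; set G := (X in <<s X >>).
apply: (@fin_bigcap_measurable _ (g_sigma_algebraType G)) => // p _.
apply: sub_gen_smallest; exists p.1, p.2; eexists; split; last exact: erefl.
by apply: measurable_expmax; exact: measurable_itv.
Qed.

Lemma rat_ball_separation {R : realType} {d : nat} (M : 'M[\bar R]_d) (e : R) :
  0 < e -> exists k, rat_ball k M /\
    forall N, rat_ball k N -> forall i j, `|expmax (N i j) - expmax (M i j)| < e.
Proof.
move=> e0; have [r] := @rat_in_itvoo R 0 (e / 2) (divr_gt0 e0 (ltr0Sn _ _)).
rewrite in_itv /= => /andP[r0 re].
have /choice[q Hq] : forall p : 'I_d * 'I_d, exists q : rat,
    `|expmax (M p.1 p.2) - ratr q| < ratr r.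
  move=> p; have [|q] := @rat_in_itvoo R (expmax (M p.1 p.2)) (expmax (M p.1 p.2) + ratr r).
    by rewrite ltrDl.
  by rewrite in_itv /= => /andP[? ?]; exists q; rewrite ltr_distlC; apply/andP; split; lra.
exists (finfun q, r); split=> [i j|N NK i j] /=; first by rewrite ffunE; exact: (Hq (i, j)).
have := NK i j; have := Hq (i, j); rewrite /= ffunE !ltr_norml => /andP[? ?] /andP[? ?].
by apply/andP; split; lra.
Qed.

(** * Almost sure membership in the support, and rank 1 elements of the semigroup *)

Section Probability.
Context {R : realType} {d : nat} {dm : measure_display} {Omega : measurableType dm}
  {P : probability Omega R} {A : nat -> Omega -> 'M[\bar R]_d}.
Hypothesis mpA : forall n w, is_maxplus_mx (A n w).
Hypothesis rA : forall n, random_mx (A n).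
Hypothesis idA : ident_distr P A.

Lemma rat_ball_event_measurable n k : measurable (A n @^-1` rat_ball k).
Proof.
rewrite rat_ball_coord preimage_bigcap.
apply: fin_bigcap_measurable => // p _; rewrite -[X in _ X]setTI.
by apply: rA => //; apply: measurable_expmax; exact: measurable_itv.
Qed.

(** A value outside the support lies in a rational ball that is null for the law of [A 0]. There are
    countably many such balls, and equality of laws makes them null for [A n]. *)
Lemma not_supp_negligible n : P.-negligible [set w | ~ supp P A (A n w)].
Proof.
pose Z (k : {ffun 'I_d * 'I_d -> rat} * rat) :=
  if `[< P (A 0%N @^-1` rat_ball k) = 0%E >] then A n @^-1` rat_ball k else set0.
(* The balls are enumerated by [unpickle]; a code of no ball gives the empty set. *)
apply: (@negligibleS _ _ _ _ (\bigcup_m oapp Z set0 (unpickle m))); last first.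
  apply: negligible_bigcup => m; case: (unpickle m) => [k|] /=.
    rewrite /Z; case: asboolP => [P0|_]; last exact: negligible_set0.
    exists (A n @^-1` rat_ball k); split=> //; first exact: rat_ball_event_measurable.
    by rewrite -P0; apply: idA; exact: rat_ball_measurable.
  exact: negligible_set0.
move=> w /= nw; have [e e0 He] : exists2 e : R, 0 < e & P [set w' | forall i j,
    `|expmax (A 0%N w' i j) - expmax (A n w i j)| < e] = 0%E.
  apply: contrapT => no; apply: nw; split=> // e e0.
  by rewrite lt0e measure_ge0 andbT; apply/eqP => P0; apply: no; exists e.
have [k [kw ke]] := rat_ball_separation (A n w) e e0.
exists (pickle k) => //=; rewrite pickleK /= /Z asboolT //.
apply: (@measure_negligible _ _ _ P); first exact: rat_ball_event_measurable.
have mE : measurable [set w' | forall i j,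
    `|expmax (A 0%N w' i j) - expmax (A n w i j)| < e].
  rewrite (_ : [set _ | _] = \bigcap_(p in [set: 'I_d * 'I_d])
    (setT `&` (fun w' => A 0%N w' p.1 p.2) @^-1` (@expmax R @^-1`
      [set` `]expmax (A n w p.1 p.2) - e, expmax (A n w p.1 p.2) + e[]))); last first.
    apply/seteqP; split=> [w' H [i j] _|w' H i j] /=.
      by split=> //; rewrite /= in_itv /= -ltr_distl H.
    by have [_] := H (i, j) I; rewrite /= in_itv /= -ltr_distl.
  apply: fin_bigcap_measurable => // p _.
  by apply: rA => //; apply: measurable_expmax; exact: measurable_itv.
(* The rational ball lies inside the null ball of radius [e] around [A n w]. *)
exists [set w' | forall i j, `|expmax (A 0%N w' i j) - expmax (A n w i j)| < e].
by split=> // w'; exact: ke.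
Qed.

Lemma measurable_bigmaxe (I : Type) (s : seq I) (f : I -> Omega -> \bar R) :
  (forall i, measurable_fun setT (f i)) ->
  measurable_fun setT (fun w => \big[maxe/-oo%E]_(i <- s) f i w).
Proof.
move=> mf; elim: s => [|i s IH].
  by under eq_fun do rewrite big_nil; exact: measurable_cst.
by under eq_fun do rewrite big_cons; exact: measurable_maxe.
Qed.

Lemma comp_list_measurable (s : seq nat) (x : vec R d) i :
  measurable_fun setT (fun w => comp_list [seq A n w | n <- s] x i).
Proof.
elim/last_ind: s i => [|s n IH] i; first exact: measurable_cst.
under eq_fun do rewrite map_rcons comp_list_rcons.
apply: (@measurableT_comp _ _ _ _ _ _ fine); first exact: fine_measurable.
apply: measurable_bigmaxe => j; apply: emeasurable_funD; first exact: rA.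
exact/measurable_EFinP.
Qed.

Lemma rank1_event_measurable (s : seq nat) : (0 < d)%N ->
  measurable [set w | rank1 (comp_list [seq A n w | n <- s])].
Proof.
move=> d0; pose i0 := Ordinal d0; pose f w := comp_list [seq A n w | n <- s].
have tf w : topical (f w).
  by apply: comp_list_topical => B /mapP[n _ ->]; exact: mpA.
rewrite (_ : [set w | _] = ~` \bigcup_(k : {ffun 'I_d -> rat} * 'I_d)
  ~` [set w | (f w (ratr \o k.1) k.2 - f w (ratr \o k.1) i0
     == f w (@vzero R d) k.2 - f w (@vzero R d) i0)]).
  apply: measurableC; apply: countable_bigcupT_measurable => [|k].
    exact: countableP.
  apply: measurableC; rewrite -[X in _ X]setTI.
  apply: (@measurable_fun_eqr _ _ _ _ _ _ _ _ measurableT [set true]) => //;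
  by apply: measurable_funB; exact: comp_list_measurable.
rewrite setC_bigcup; apply/seteqP; split=> w /=.
  move=> /(rank1_rational _ i0 (tf w)) H k _; rewrite setCK; apply/eqP; exact: H.
move=> H; apply/(rank1_rational _ i0 (tf w)) => v i.
by have := H (v, i) I; rewrite setCK => /eqP.
Qed.

(** Were there no such element, the rank 1 event would force some [A n] out of the support and hence
    be null. *)
Lemma memory_loss_semigrp : (0 < d)%N -> memory_loss P A ->
  exists2 f, semigrp P A f & rank1 f.
Proof.
move=> d0 [N PN]; apply: contrapT => nof; move: PN; set E := [set w | _].
suff -> : P E = 0%E by rewrite ltxx.
apply: measure_negligible; first exact: rank1_event_measurable.
apply: (@negligibleS _ _ _ _ (\bigcup_n [set w | ~ supp P A (A n w)])).
  move=> w Ew; apply: contrapT => nw; apply: nof.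
  exists (comp_list [seq A n w | n <- iota 0%N N.+1]) => //.
  exists [seq A n w | n <- iota 0%N N.+1]; split=> //; split=> //.
  move=> B /mapP[n _ ->]; apply: contrapT => nB; apply: nw; by exists n.
by apply: negligible_bigcup => n; exact: not_supp_negligible.
Qed.

(** This lets arithmeticity be applied with every [B^m f] as [theta']. *)
Lemma semigrp_iter B f m : supp P A B -> semigrp P A f -> rank1 f ->
  semigrp P A (iter m (mp_op B) \o f) /\ rank1 (iter m (mp_op B) \o f).
Proof.
move=> sB sf rf; elim: m => [//|m [[l [l0 [lS lE]]] rm]]; split.
  exists (rcons l B); split; first by case: (l).
  split; last by rewrite comp_list_rcons -lE.
  by move=> C; rewrite mem_rcons inE => /orP[/eqP->|/lS].
move=> x y; have [c /= cE] := rm x y; exists c.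
by rewrite /= cE (mp_op_topical sB.1).2.
Qed.

End Probability.

Theorem theorem2p10 (R : realType) (d : nat) (dm : measure_display)
  (Omega : measurableType dm) (P : probability Omega R)
  (A : nat -> Omega -> 'M[\bar R]_d) (X0 : Omega -> vec R d) :
  (0 < d)%N ->
  (forall n w, is_maxplus_mx (A n w)) ->
  iid P A ->
  memory_loss P A ->
  (exists eps : R, 0 < eps /\
     (\int[P]_w (powR (supnorm (mp_op (A 0%N w) (@vzero R d))) (4 + eps))%:E < +oo)%E) ->
  Linfty_vec P X0 ->
  indep_sigma P (sigma_seq A) (sigma_vec X0) ->
  alg_arithmetic P A ->
  exists a b : R, forall B : 'M[\bar R]_d,
    supp P A B -> strongly_connected B ->
    exists k : int, rho_max B = (a + b * k%:~R)%:E.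
Proof.
move=> d0 mpA [rA [_ idA]] mloss _ _ _ [a [b [theta [ttheta [_ arith]]]]].
have [f sf rf] := memory_loss_semigrp mpA rA idA d0 mloss.
(* The denominator depends only on [d], so one pair serves all [B]. *)
exists a, (b / d`!%:R) => B sB scB.
apply: (rho_max_lattice B theta a b (f (@vzero R d)) sB.1 scB d0 ttheta) => m.
have [sm rm] := semigrp_iter B f m sB sf rf.
exact: (arith B sB _ sm rm (@vzero R d)).
Qed.
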